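(* Let $n,d,k$ be such that the $(B_0,d,n)$-block model is defined, and let $\epsilon>0$. Suppose there is an $\epsilon$-differentially node private algorithm such that for any symmetric matrix $B_0\in[0,4]^{k\times k}$ with entries averaging to $1$, on input $\mathbf G$ sampled from the $(B_0,d,n)$-block model, it outputs $\hat B(\mathbf G)\in\mathbb R^{k\times k}$ satisfying \[\Pr\left(\delta_2(\hat B(\mathbf G),B_0)\le\tfrac1{20}\right)\ge\tfrac23.\] Then $n\ge\Omega(k^2/\epsilon)$.
   Context: The $(B_0,d,n)$-block model ($n$ a multiple of $k$, $2\le d\le n$): partition $[n]$ uniformly at random into $k$ equal parts; for parts $a,b$ and vertices $i,j$ in parts $a,b$, connect $i,j$ independently with probability $\frac dn B_0(a,b)$. For $B\in\mathbb R^{k\times k}$ and $\phi:[0,1]\to[k]$ let $B^\phi(x,y)=B(\phi(x),\phi(y))$; $\phi$ is measure preserving if every preimage $\phi^{-1}(a)$ has measure $1/k$; $\delta_2(B_1,B_2)=\min_{\phi_1,\phi_2}\|B_1^{\phi_1}-B_2^{\phi_2}\|_{L_2([0,1]^2)}$ over measure-preserving $\phi_1,\phi_2$. An algorithm is $\epsilon$-differentially node private if $\Pr[\mathcal A(G)\in S]\le e^\epsilon\Pr[\mathcal A(G')\in S]$ for all events $S$ and all graphs $G,G'$ that can be made isomorphic by removing exactly one vertex from each.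
   Formalization: The formal theorem assumes k ≥ 2: for k = 1 the only admissible B_0 is (1), so the constant algorithm is ε-private and always succeeds, and n ≥ Ω(k²/ε) fails as ε → 0 with n fixed. *)

(* Defs.v *)
From HB Require Import structures.
From mathcomp Require Import all_boot all_order all_algebra.
From mathcomp Require Import all_classical all_reals all_analysis.

Set Implicit Arguments.
Unset Strict Implicit.
Unset Printing Implicit Defensive.

Import Order.TTheory GRing.Theory Num.Theory.
Import numFieldNormedType.Exports.

Local Open Scope classical_set_scope.
Local Open Scope ring_scope.

Definition is_sgraph (n : nat) (e : {ffun 'I_n * 'I_n -> bool}) : bool :=
  [forall i, ~~ e (i, i)] && [forall i, forall j, e (i, j) == e (j, i)].

Record sgraph (n : nat) := SGraph {
  adjf : {ffun 'I_n * 'I_n -> bool};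
  _ : is_sgraph adjf }.

HB.instance Definition _ (n : nat) := [isSub for @adjf n].
HB.instance Definition _ (n : nat) := [Finite of sgraph n by <:].

Definition adj (n : nat) (G : sgraph n) (i j : 'I_n) : bool := adjf G (i, j).

(* [G - v] and [G' - v'] are isomorphic for some vertices [v] and [v']. *)
Definition node_neighbors (n : nat) (G G' : sgraph n) : Prop :=
  exists (v v' : 'I_n) (f : {x : 'I_n | x != v} -> {x : 'I_n | x != v'}),
    bijective f /\
    forall x y, adj G (val x) (val y) = adj G' (val (f x)) (val (f y)).

Definition block_model_defined (R : realType) (n k : nat) (d : R)
    (B : 'M[R]_k) : Prop :=
  [/\ (0 < k)%N, (k %| n)%N, 2 <= d <= n%:R &
      forall a b, 0 <= d / n%:R * B a b <= 1].

(* A partition of ['I_n] into [k] equal parts labelled by ['I_k] is encoded by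
   the function sending each vertex to the label of its part. *)
Definition equipartitions (n k : nat) : {set {ffun 'I_n -> 'I_k}} :=
  [set s : {ffun 'I_n -> 'I_k} |
    [forall a, #|[set i | s i == a]| == (n %/ k)%N]]%SET.

(* Probability of [G] conditionally on the partition [s]. *)
Definition block_model_cond (R : realType) (n k : nat) (d : R) (B : 'M[R]_k)
    (s : {ffun 'I_n -> 'I_k}) (G : sgraph n) : R :=
  \prod_(i < n) \prod_(j < n | (i < j)%N)
    (let p := d / n%:R * B (s i) (s j) in if adj G i j then p else 1 - p).

Definition block_model (R : realType) (n k : nat) (d : R) (B : 'M[R]_k)
    (G : sgraph n) : R :=
  #|equipartitions n k|%:R^-1 *
    \sum_(s in equipartitions n k) block_model_cond d B s G.

(* Only the values on [0, 1] of [phi] matter. *)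
Definition measure_preserving (R : realType) (k : nat) (phi : R -> 'I_k) :
    Prop :=
  forall a : 'I_k, let X := `[0, 1] `&` phi @^-1` [set a] in
    measurable X /\ lebesgue_measure X = (k%:R^-1)%:E :> \bar R.

Definition pullback (R : realType) (k : nat) (B : 'M[R]_k) (phi : R -> 'I_k)
    (z : R * R) : R :=
  B (phi z.1) (phi z.2).

Definition L2norm (R : realType) (f : R * R -> R) : R :=
  Num.sqrt (\int[(lebesgue_measure \x lebesgue_measure)%E]_(z in
              `[0%R, 1%R]%classic `*` `[0%R, 1%R]%classic) (f z ^+ 2)).

(* The infimum is attained: the norm depends on [phi1] and [phi2] only through
   the measures of the sets where [(phi1, phi2) = (a, b)], which range over a
   compact set. *)
Definition delta2 (R : realType) (k : nat) (B1 B2 : 'M[R]_k) : R :=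
  inf [set r | exists phi1 phi2 : R -> 'I_k,
        [/\ measure_preserving phi1, measure_preserving phi2 &
            r = L2norm (pullback B1 phi1 \- pullback B2 phi2)]].

Definition borel_matrix (R : realType) (k : nat) :=
  g_sigma_algebraType (@open 'M[R]_k).

(* [A G S] is the probability that the output on input [G] lies in [S]. *)
Definition algorithm (R : realType) (n k : nat) :=
  sgraph n -> probability (borel_matrix R k) R.

Definition node_private (R : realType) (n k : nat) (eps : R)
    (A : algorithm R n k) : Prop :=
  forall G G' : sgraph n, node_neighbors G G' ->
  forall S : set (borel_matrix R k), measurable S ->
    (A G S <= (expR eps)%:E * A G' S)%E.

Definition admissible (R : realType) (k : nat) (B : 'M[R]_k) : Prop :=
  [/\ B^T = B, forall a b, 0 <= B a b <= 4 &
      (\sum_a \sum_b B a b) / (k ^ 2)%:R = 1].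

(* Probability, over [G] drawn from the block model of [B] and the internal
   randomness of [A], that the output is within [delta2]-distance [r] of [B]. *)
Definition success_probability (R : realType) (n k : nat) (d : R)
    (A : algorithm R n k) (B : 'M[R]_k) (r : R) : \bar R :=
  (\sum_(G : sgraph n)
     (block_model d B G)%:E * A G [set Bhat | (delta2 Bhat B <= r)%R])%E.

(* Main.v *)
Require Import Defs.
From HB Require Import structures.
From mathcomp Require Import all_boot all_order all_algebra.
From mathcomp Require Import all_classical all_reals all_analysis.
From mathcomp Require Import measurable_realfun.
From mathcomp Require Import ring lra zify.

Import Order.TTheory GRing.Theory Num.Theory.
Import numFieldNormedType.Exports.
Local Open Scope ring_scope.

(* Two graphs on [n] vertices are linked by [n] rewirings of a vertex, so under
   [eps]-node privacy every event keeps its probability up to [e^(n eps)]. Hence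
   one fixed input graph (the empty one) must produce, with probability at least
   [2/3 e^(-n eps)], an output close to [B], and this for all [B] at once.

   For large [k], take [2^(k^2)] matrices [B_X] indexed by bit arrays [X], with
   entries [1 +- 1] prescribed by [X] on a grid of [(k/4)^2] positions. A given
   output is close to few of them. Indeed, if [delta2 Bhat B_X] is small, some
   coupling [w] of the labels has small cost; reading [k w] as a Markov kernel
   and drawing [f b = a] with probability [k w(a, b)], independently over [b],
   the expected distance between [Bhat(f b, f b')] and [B_X(b, b')] off the
   diagonal is at most that cost. So some map [f : [k] -> [k]] (not necessarily
   a bijection) makes [X] close in Hamming distance to a bit array that depends
   on [Bhat] and [f] only; there are [k^k] maps, while Hamming balls contain an
   [e^(-Omega(k^2))] fraction of all bit arrays. Therefore
   [e^(n eps) k^k e^(-Omega(k^2)) >= 2/3].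

   For bounded [k], it is enough that no output is close to both the all-ones
   matrix and the matrix [1 + s s^T], where [s] alternates between [1] and [-1]
   (and ends with [0] if [k] is odd). *)

(** * Group privacy along a chain of hybrid graphs *)

Lemma hybrid_sgraph_subproof (n t : nat) (G G' : sgraph n) :
  is_sgraph [ffun p : 'I_n * 'I_n =>
    if ((p.1 < t) || (p.2 < t))%N then adj G' p.1 p.2 else adj G p.1 p.2].
Proof.
have /andP[/forallP irr /forallP sym] := valP G.
have /andP[/forallP irr' /forallP sym'] := valP G'.
apply/andP; split; apply/forallP => i.
  by rewrite ffunE /=; case: ifP => _; [exact: irr'|exact: irr].
apply/forallP => j; rewrite !ffunE /= orbC.
by case: ifP => _; [exact: (forallP (sym' i) j)|exact: (forallP (sym i) j)].
Qed.

Definition hybrid_sgraph (n t : nat) (G G' : sgraph n) : sgraph n :=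
  SGraph (hybrid_sgraph_subproof n t G G').

Lemma sgraph_eq (n : nat) (G G' : sgraph n) : adj G =2 adj G' -> G = G'.
Proof. by move=> eqG; apply/val_inj/ffunP => -[i j]; exact: eqG. Qed.

Lemma hybrid_sgraphE (n t : nat) (G G' : sgraph n) i j :
  adj (hybrid_sgraph n t G G') i j =
  if ((i < t) || (j < t))%N then adj G' i j else adj G i j.
Proof. by rewrite /adj /= ffunE. Qed.

(** The hybrids at [t] and [t.+1] differ only in pairs containing vertex [t], so deleting it from
    both leaves the same graph. Each of the [n] steps from [G] to [G'] costs a factor [expR eps]. *)
Lemma node_private_group (R : realType) (n k : nat) (eps : R)
    (A : algorithm R n k) (G G' : sgraph n) (S : set (borel_matrix R k)) :
  node_private eps A -> measurable S ->
  (A G S <= (expR (n%:R * eps))%:E * A G' S)%E.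
Proof.
move=> privA mS.
have step (t : nat) : (t <= n)%N ->
    (A G S <= (expR (t%:R * eps))%:E * A (hybrid_sgraph n t G G') S)%E.
  elim: t => [_|t IHt ltn].
    rewrite mul0r expR0 mul1e (_ : hybrid_sgraph n 0 G G' = G)//.
    by apply: sgraph_eq => i j; rewrite hybrid_sgraphE.
  apply: le_trans (IHt (ltnW ltn)) _.
  rewrite -natr1 mulrDl mul1r expRD EFinM -muleA.
  apply: lee_wpmul2l; first by rewrite lee_fin expR_ge0.
  apply: privA => //; exists (Ordinal ltn), (Ordinal ltn), id; split.
    exact: (Bijective (g := id)).
  move=> [x /= xt] [y /= yt]; rewrite !hybrid_sgraphE.
  have ne (z : 'I_n) : z != Ordinal ltn -> (z < t.+1)%N = (z < t)%N.
    by move=> zt; rewrite ltnS [LHS]leq_eqVlt (negPf (_ : z != t :> nat)).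
  by rewrite !ne.
apply: le_trans (step n (leqnn n)) _.
rewrite (_ : hybrid_sgraph n n G G' = G')//.
by apply: sgraph_eq => i j; rewrite hybrid_sgraphE ltn_ord.
Qed.

Lemma empty_sgraph_subproof (n : nat) :
  is_sgraph [ffun _ : 'I_n * 'I_n => false].
Proof.
by apply/andP; split; apply/forallP => i; [|apply/forallP => j]; rewrite !ffunE.
Qed.

Definition empty_sgraph (n : nat) : sgraph n :=
  SGraph (empty_sgraph_subproof n).

(** * The block model has total mass at most 1 *)

Section BlockModel.
Context {R : realType} {n k : nat} {d : R} {B : 'M[R]_k}.
Hypothesis defB : block_model_defined n d B.

Let bernoulli (p : R) (b : bool) : R := if b then p else 1 - p.

Let bernoulli_ge0 p b : 0 <= p <= 1 -> 0 <= bernoulli p b.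
Proof. by move=> /andP[p0 p1]; case: b; rewrite //= subr_ge0. Qed.

Lemma block_model_cond_ge0 s (G : sgraph n) : 0 <= block_model_cond d B s G.
Proof.
have [_ _ _ pB] := defB.
apply: prodr_ge0 => i _; apply: prodr_ge0 => j _.
exact: (bernoulli_ge0 _ _ (pB _ _)).
Qed.

Lemma block_model_ge0 (G : sgraph n) : 0 <= block_model d B G.
Proof.
apply: mulr_ge0; first by rewrite invr_ge0.
by apply: sumr_ge0 => s _; exact: block_model_cond_ge0.
Qed.

Lemma block_model_cond_sum_le1 s :
  \sum_(G : sgraph n) block_model_cond d B s G <= 1.
Proof.
have [_ _ _ pB] := defB.
pose p (e : 'I_n * 'I_n) : R := d / n%:R * B (s e.1) (s e.2).
(* Pairs above the diagonal carry a Bernoulli law and all other pairs are forced to [false], so the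
   weights of all bit functions sum to 1. *)
pose w (e : 'I_n * 'I_n) (b : bool) : R :=
  if (e.1 < e.2)%N then bernoulli (p e) b else (~~ b)%:R.
have w0 e b : 0 <= w e b.
  by rewrite /w; case: ifP => _; [apply: bernoulli_ge0; exact: pB|].
have w1 : \sum_(f : {ffun 'I_n * 'I_n -> bool}) \prod_e w e (f e) = 1.
  rewrite -(bigA_distr_bigA w) big1// => e _.
  rewrite big_bool /w /bernoulli; case: ifP => _ /=; last by rewrite add0r.
  by rewrite addrCA subrr addr0.
(* Recording the edges above the diagonal embeds graphs into bit functions and preserves weights;
   the sum over graphs is thus a partial sum of [w1]. *)
pose up (G : sgraph n) : {ffun 'I_n * 'I_n -> bool} :=
  [ffun e : 'I_n * 'I_n => (e.1 < e.2)%N && adj G e.1 e.2].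
have up_inj : injective up.
  move=> G G' eqG; apply: sgraph_eq => i j.
  have lt_eq (x y : 'I_n) : (x < y)%N -> adj G x y = adj G' x y.
    by move=> xy; have /ffunP/(_ (x, y)) := eqG; rewrite !ffunE /= xy.
  have /andP[/forallP irr /forallP sym] := valP G.
  have /andP[/forallP irr' /forallP sym'] := valP G'.
  case: (ltngtP i j) => [|ji|/val_inj->]; first exact: lt_eq.
    transitivity (adj G j i); first exact/eqP/(forallP (sym i) j).
    by rewrite lt_eq//; exact/eqP/(forallP (sym' j) i).
  transitivity false; first exact/negbTE/irr.
  exact/esym/negbTE/irr'.
have condE G : block_model_cond d B s G = \prod_e w e (up G e).
  rewrite /block_model_cond pair_big_dep /=.
  rewrite [RHS](bigID (fun e : 'I_n * 'I_n => (e.1 < e.2)%N)) /=.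
  rewrite [X in _ = _ * X]big1 ?mulr1; last first.
    by move=> e /negbTE ne; rewrite /w ne /up ffunE ne.
  by apply: eq_bigr => e lte; rewrite /w lte /up ffunE lte.
rewrite (eq_bigr _ (fun G _ => condE G)).
rewrite -(big_imset (fun f : {ffun _ -> bool} => \prod_e w e (f e))
  (in2W up_inj)) /=.
rewrite -[leRHS]w1 [leRHS](bigID (mem [set up x | x : sgraph n]%SET)) /= lerDl.
by apply: sumr_ge0 => f _; apply: prodr_ge0 => e _.
Qed.

Lemma block_model_sum_le1 : \sum_(G : sgraph n) block_model d B G <= 1.
Proof.
rewrite -mulr_sumr exchange_big /=.
apply: (@le_trans _ _ (#|equipartitions n k|%:R^-1 * #|equipartitions n k|%:R)).
  apply: ler_wpM2l; first by rewrite invr_ge0.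
  rewrite -sumr_const; apply: ler_sum => s _; exact: block_model_cond_sum_le1.
by have [->|N0] := eqVneq #|equipartitions n k| 0%N;
  rewrite ?mulr0// mulVf// pnatr_eq0.
Qed.

End BlockModel.

(** * Couplings of labels and the L2 distance *)

Local Open Scope classical_set_scope.

Definition coupling {R : realType} {k : nat} (phi1 phi2 : R -> 'I_k)
    (p : 'I_k * 'I_k) : set R :=
  `[0, 1] `&` phi1 @^-1` [set p.1] `&` phi2 @^-1` [set p.2].

Definition coupling_weight {R : realType} {k : nat} (phi1 phi2 : R -> 'I_k)
    (a b : 'I_k) : R :=
  fine (lebesgue_measure (coupling phi1 phi2 (a, b))).

(** A Gromov-Wasserstein type distortion: the mean squared discrepancy when [(a, b)] and [(a', b')]
    are drawn independently from [w]. *)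
Definition coupling_cost {R : realType} {k : nat} (w : 'I_k -> 'I_k -> R)
    (B1 B2 : 'M[R]_k) : R :=
  \sum_a \sum_b \sum_a' \sum_b' w a b * w a' b' * (B1 a a' - B2 b b') ^+ 2.

Section Coupling.
Context {R : realType} {k : nat} {phi1 phi2 : R -> 'I_k}.
Hypothesis mphi1 : measure_preserving phi1.
Hypothesis mphi2 : measure_preserving phi2.
Let E := coupling phi1 phi2.
Let w := coupling_weight phi1 phi2.
Let mu := @lebesgue_measure R.

Lemma measurable_coupling p : measurable (E p).
Proof.
rewrite /E /coupling -(setIid `[0, 1]) -setIA setIACA.
have [m1 _] := mphi1 p.1; have [m2 _] := mphi2 p.2; exact: measurableI.
Qed.

Let mE := measurable_coupling.

Let muE a b : mu (E (a, b)) = (w a b)%:E.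
Proof.
rewrite fineK// ge0_fin_numE//.
apply: (@le_lt_trans _ _ (mu `[0, 1])).
  apply: le_measure; rewrite ?inE; [exact: mE|exact: measurable_itv|].
  by move=> x [[]].
by rewrite /mu lebesgue_measure_itv /= lte_fin ltr01 -EFinB ltry.
Qed.

Lemma coupling_weight_ge0 a b : 0 <= w a b.
Proof. exact/fine_ge0/measure_ge0. Qed.

Lemma coupling_weight_swap a b :
  coupling_weight phi2 phi1 b a = coupling_weight phi1 phi2 a b.
Proof. by rewrite /coupling_weight /coupling /= -setIA setIAC setIA. Qed.

Lemma coupling_weight_suml b : \sum_a w a b = k%:R^-1.
Proof.
have [mX muX] := mphi2 b.
apply: EFin_inj; rewrite -muX -sumEFin.
transitivity (\sum_a \int[mu]_x (\1_(E (a, b)) x)%:E)%E.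
  apply: eq_bigr => a _; rewrite integral_indic//; last exact: mE.
  by rewrite setIT -muE.
rewrite -ge0_integral_sum//; last first.
  by move=> a; apply/measurable_EFinP/measurable_indic; exact: mE.
transitivity
  (\int[mu]_x (\1_(`[0, 1] `&` phi2 @^-1` [set b]) x)%:E)%E; last first.
  by rewrite integral_indic// setIT.
apply: eq_integral => x _; rewrite sumEFin; congr EFin.
have [xX|xX] := boolP (x \in `[0, 1] `&` phi2 @^-1` [set b]); last first.
  rewrite !indicE (negPf xX) big1// => a _; rewrite indicE.
  case: (boolP (x \in _)) => //; rewrite inE => -[[x01 _] x2].
  by move: xX; rewrite notin_setE => /(_ (conj x01 x2)).
rewrite [RHS]indicE xX (bigD1 (phi1 x))//= big1 ?addr0.
  move: xX; rewrite inE => -[x01 x2].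
  by rewrite indicE mem_set//; split => //; split.
move=> a ax; rewrite indicE memNset// => -[[_ /= xa] _].
by rewrite xa eqxx in ax.
Qed.

(** The integrand is constant on each product of two coupling sets, and these products tile the unit
    square. *)
Lemma L2norm_coupling (B1 B2 : 'M[R]_k) :
  L2norm (pullback B1 phi1 \- pullback B2 phi2) =
  Num.sqrt (coupling_cost w B1 B2).
Proof.
rewrite /L2norm; congr Num.sqrt; rewrite /Rintegral.
pose D : set (R * R) := `[0%R, 1%R] `*` `[0%R, 1%R].
have mD : measurable D by exact: measurableX.
pose c (p q : 'I_k * 'I_k) := (B1 p.1 q.1 - B2 p.2 q.2) ^+ 2.
transitivity (fine (\int[mu \x mu]_(z in D)
   \sum_(r : ('I_k * 'I_k) * ('I_k * 'I_k))
     ((c r.1 r.2)%:E * (\1_(E r.1 `*` E r.2) z)%:E)))%E.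
  congr fine.
  apply: eq_integral => -[x y]; rewrite inE => -[/= x01 y01].
  rewrite (bigD1 ((phi1 x, phi2 x), (phi1 y, phi2 y)))//= big1 ?adde0.
    by rewrite indicE mem_set ?mule1.
  move=> [[a b] [a' b']] /= ne; rewrite indicE memNset ?mule0//.
  move=> -[[[_ /= xa] xb] [[_ /= ya] yb]].
  by rewrite xa xb ya yb eqxx in ne.
have mEE r : measurable (E r.1 `*` E r.2 : set (_ * _)) by exact: measurableX.
rewrite ge0_integral_sum//; last 2 first.
- move=> r; apply: emeasurable_funM => //.
  apply/measurable_EFinP/measurable_indic; exact: mEE.
- by move=> r z _; rewrite mule_ge0// lee_fin// sqr_ge0.
have E01 p : E p `<=` `[0, 1] by move=> x [[]].
transitivity (fine (\sum_(r : ('I_k * 'I_k) * ('I_k * 'I_k))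
   (c r.1 r.2 * (w r.1.1 r.1.2 * w r.2.1 r.2.2))%:E))%E.
  congr fine; apply: eq_bigr => -[[a b] [a' b']] _ /=.
  rewrite ge0_integralZl_EFin ?sqr_ge0//; last first.
    apply/measurable_EFinP/measurable_indic.
    exact: (mEE ((a, b), (a', b'))).
  rewrite integral_indic//; last exact: (mEE ((a, b), (a', b'))).
  rewrite setIidl; last by apply: setSX; exact: E01.
  rewrite [RHS]EFinM (EFinM (w a b)) -!muE; congr (_ * _)%E.
  by apply: product_measure1E; exact: mE.
rewrite sumEFin /=.
rewrite -(pair_bigA _ (fun p q => c p q * (w p.1 p.2 * w q.1 q.2))) /=.
rewrite -(pair_bigA _
  (fun a b => \sum_q c (a, b) q * (w a b * w q.1 q.2))) /=.
apply: eq_bigr => a _; apply: eq_bigr => b _.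
rewrite -(pair_bigA _
  (fun a' b' => c (a, b) (a', b') * (w a b * w a' b'))) /=.
by apply: eq_bigr => a' _; apply: eq_bigr => b' _; rewrite mulrC.
Qed.

Lemma coupling_cost_ge0 B1 B2 : 0 <= coupling_cost w B1 B2.
Proof.
rewrite /coupling_cost.
apply: sumr_ge0 => a _; apply: sumr_ge0 => b _.
apply: sumr_ge0 => a' _; apply: sumr_ge0 => b' _.
apply: mulr_ge0; last exact: sqr_ge0.
by apply: mulr_ge0; exact: coupling_weight_ge0.
Qed.

Lemma L2norm_coupling_lt (B1 B2 : 'M[R]_k) (r : R) : 0 <= r ->
  (L2norm (pullback B1 phi1 \- pullback B2 phi2) < r) =
  (coupling_cost w B1 B2 < r ^+ 2).
Proof.
rewrite le_eqVlt => /predU1P[<-|r0].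
  by rewrite expr0n /= !ltNge coupling_cost_ge0 /L2norm sqrtr_ge0.
rewrite L2norm_coupling -{1}(gtr0_norm r0) -sqrtr_sqr ltr_sqrt//.
by rewrite exprn_gt0.
Qed.
End Coupling.

(** * Balls for [delta2] and their measurability *)

Lemma exists_measure_preserving (R : realType) (k : nat) : (0 < k)%N ->
  exists phi : R -> 'I_k, measure_preserving phi.
Proof.
case: k => // k _; set K : R := k.+1%:R.
have K0 : 0 < K by rewrite ltr0n.
(* Truncation cuts [0, 1] into intervals of length [K^-1], closed on the left. The cap [minn] sends
   the endpoint 1 to the last label, whose interval is therefore closed on the right as well. *)
exists (fun x => inord (minn (Num.truncn (K * x)) k)) => a X.
have -> : X = [set` Interval (BLeft (a%:R / K))
                 (BSide (a != ord_max) (a.+1%:R / K))].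
  apply/seteqP; split => [x [/= x01 xa]|x /=].
    move: x01; rewrite !in_itv /= => /andP[x0 x1].
    have Kx0 : 0 <= K * x by rewrite mulr_ge0// ltW.
    have := congr1 val xa; rewrite /= inordK ?ltnS ?geq_minr// => ea.
    rewrite ler_pdivrMr// mulrC -truncn_ge_nat// -{1}ea geq_minl /=.
    case: (eqVneq a ord_max) => [am|am] /=.
      by rewrite am /= divff// gt_eqF.
    rewrite ltr_pdivlMr// mulrC -truncn_le_nat.
    have /eqP : (a : nat) != k by [].
    by rewrite -ea; move: (Num.truncn _) => t; lia.
  rewrite in_itv /= => /andP[ax xa].
  have x0 : 0 <= x by apply: le_trans ax; rewrite divr_ge0// ltW.
  have Kx0 : 0 <= K * x by rewrite mulr_ge0// ltW.
  have x1 : x <= 1.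
    have : x <= a.+1%:R / K by case: (a != ord_max) xa => //= /ltW.
    by move=> /le_trans; apply; rewrite ler_pdivrMr// mul1r ler_nat.
  split; first by rewrite /= in_itv /= x0.
  apply: val_inj => /=; rewrite inordK ?ltnS ?geq_minr//.
  have la : (a <= Num.truncn (K * x))%N.
    by rewrite truncn_ge_nat// mulrC -ler_pdivrMr.
  have := ltn_ord a; case: (eqVneq a ord_max) xa la => [-> _ /=|am xa].
    by move: (Num.truncn _) => t; lia.
  have /eqP : (a : nat) != k by [].
  have : (Num.truncn (K * x) <= a)%N.
    by rewrite truncn_le_nat mulrC -ltr_pdivlMr.
  by move: (Num.truncn _) (a : nat) => t b; lia.
split; first exact: measurable_itv.
rewrite lebesgue_measure_itv /= lte_fin ltr_pM2r ?invr_gt0// ltr_nat ltnSn.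
by rewrite -EFinB -mulrBl -[a.+1%:R]natr1 addrAC subrr add0r mul1r.
Qed.

Lemma continuous_sum (R : realType) (T : topologicalType) (I : finType)
    (f : I -> T -> R) :
  (forall i, continuous (f i)) -> continuous (fun x => \sum_i f i x).
Proof.
move=> cf x; apply: cvg_big => [|i _]; last exact: cf.
exact: add_continuous.
Qed.

Section Delta2.
Context {R : realType} {k : nat}.
Hypothesis k0 : (0 < k)%N.

(** An infimum lies below [r] exactly when some element does. The strict form is what lets later
    arguments extract an actual coupling. *)
Lemma delta2_ltP (B1 B2 : 'M[R]_k) (r : R) : 0 <= r ->
  delta2 B1 B2 < r <->
  exists phi : (R -> 'I_k) * (R -> 'I_k),
    (measure_preserving phi.1 /\ measure_preserving phi.2) /\
    coupling_cost (coupling_weight phi.1 phi.2) B1 B2 < r ^+ 2.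
Proof.
move=> r0; rewrite /delta2; set D := [set _ | _]; split.
  have [phi mphi] := @exists_measure_preserving R k k0.
  have D0 : D !=set0.
    by exists (L2norm (pullback B1 phi \- pullback B2 phi)), phi, phi.
  move=> /(inf_lt D0)[_ [phi1 [phi2 [m1 m2 ->]]]].
  by rewrite L2norm_coupling_lt// => ?; exists (phi1, phi2).
move=> [[phi1 phi2] /= [[m1 m2]]]; rewrite -L2norm_coupling_lt//.
apply: le_lt_trans; apply: ge_inf; last by exists phi1, phi2.
by exists 0 => _ [? [? [_ _ ->]]]; exact: sqrtr_ge0.
Qed.

Lemma continuous_coupling_cost (w : 'I_k -> 'I_k -> R) (B : 'M[R]_k) :
  continuous (fun Bhat : 'M[R]_k => coupling_cost w Bhat B).
Proof.
apply: continuous_sum => a; apply: continuous_sum => b.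
apply: continuous_sum => a'; apply: continuous_sum => b' M.
have cB : {for M, continuous (fun N : 'M[R]_k => N a a' - B b b')}.
  apply: (@continuousB _ _ _ (fun N : 'M[R]_k => N a a') (cst (B b b'))).
    exact: coord_continuous.
  exact: cst_continuous.
apply: (@continuousM _ _ (cst (w a b * w a' b'))
  (fun N : 'M[R]_k => (N a a' - B b b') ^+ 2)); first exact: cst_continuous.
exact: (continuousM cB cB).
Qed.

(** For fixed labellings the cost is continuous in [Bhat], so an open ball is a union of open sets;
    a closed ball is a countable intersection of open ones. *)
Lemma measurable_delta2_ball (B : 'M[R]_k) (r : R) : 0 <= r ->
  measurable ([set Bhat | delta2 Bhat B <= r] : set (borel_matrix R k)).
Proof.
move=> r0.
have oB (s : R) : 0 <= s -> open [set Bhat : 'M[R]_k | delta2 Bhat B < s].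
  move=> s0.
  have -> : [set Bhat : 'M[R]_k | delta2 Bhat B < s] =
    \bigcup_(phi in [set phi : (R -> 'I_k) * (R -> 'I_k) |
          measure_preserving phi.1 /\ measure_preserving phi.2])
      ((coupling_cost (coupling_weight phi.1 phi.2))^~ B
         @^-1` [set x | x < s ^+ 2]).
    apply/seteqP; split => Bhat /=.
      by move=> /(delta2_ltP Bhat B s s0)[phi [mphi cost]]; exists phi.
    move=> [phi mphi cost]; apply/delta2_ltP => //; by exists phi.
  apply: bigcup_open => phi _; apply: open_comp; last exact: open_lt.
  by move=> M _; exact: continuous_coupling_cost.
have -> : [set Bhat | delta2 Bhat B <= r] =
    \bigcap_n [set Bhat | delta2 Bhat B < r + n.+1%:R^-1].
  apply/seteqP; split => Bhat /=.
    by move=> /le_lt_trans + n _; apply; rewrite ltrDl invr_gt0.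
  move=> H; rewrite leNgt; apply/negP => /ltr_add_invr[n].
  by move=> /(lt_trans (H n I)); rewrite ltxx.
apply: bigcapT_measurable => n; apply: sub_sigma_algebra.
by apply: oB; rewrite addr_ge0// invr_ge0.
Qed.

End Delta2.

Local Close Scope classical_set_scope.

(** * Rounding a coupling to a map by the first moment method *)

Section RandomAssignment.
Context {R : realDomainType} {I J : finType} (P : I -> J -> R).
Hypothesis P1 : forall i, \sum_j P i j = 1.

Let W (f : {ffun I -> J}) : R := \prod_i P i (f i).

(** [W] is a product law, so distinct coordinates are independent; those other than [i] and [i'] sum
    out to 1. *)
Lemma sum_prod_marginal2 (i i' : I) (u v : J -> R) : i != i' ->
  \sum_(f : {ffun I -> J}) W f * (u (f i) * v (f i')) =
  (\sum_j P i j * u j) * (\sum_j P i' j * v j).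
Proof.
move=> ii'.
pose F l j :=
  P l j * ((if l == i then u j else 1) * (if l == i' then v j else 1)).
transitivity (\sum_(f : {ffun I -> J}) \prod_l F l (f l)).
  apply: eq_bigr => f _; rewrite big_split big_split /=; congr (_ * (_ * _)).
  - by rewrite -big_mkcond big_pred1_eq.
  - by rewrite -big_mkcond big_pred1_eq.
rewrite -(bigA_distr_bigA F) (bigD1 i)//= (bigD1 i') /=; last by rewrite eq_sym.
rewrite [X in _ * (_ * X)]big1 ?mulr1.
  congr (_ * _); apply: eq_bigr => j _; rewrite /F eqxx ?(negPf ii') ?mulr1//.
  by rewrite eq_sym (negPf ii') mul1r.
move=> l /andP[li li']; rewrite -[RHS](P1 l); apply: eq_bigr => j _.
by rewrite /F (negPf li) (negPf li') !mulr1.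
Qed.

Lemma expectation_pair (i i' : I) (g : J -> J -> R) : i != i' ->
  \sum_(f : {ffun I -> J}) W f * g (f i) (f i') =
  \sum_j \sum_j' P i j * P i' j' * g j j'.
Proof.
move=> ii'.
(* Splitting by the value [j] of [f i] reduces a general [g] to product functions. *)
transitivity (\sum_j \sum_(f : {ffun I -> J})
    W f * ((f i == j)%:R * g j (f i'))).
  rewrite exchange_big; apply: eq_bigr => f _ /=.
  rewrite -mulr_sumr (bigD1 (f i))//= eqxx mul1r big1 ?addr0// => j.
  by rewrite eq_sym => /negbTE ->; rewrite mul0r.
apply: eq_bigr => j _.
rewrite (sum_prod_marginal2 _ _ (fun x => (x == j)%:R))//.
rewrite (bigD1 j)//= eqxx mulr1 big1 ?addr0; last first.
  by move=> x /negbTE ->; rewrite mulr0.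
by rewrite mulr_sumr; apply: eq_bigr => j' _; rewrite mulrA.
Qed.

Hypothesis P0 : forall i j, 0 <= P i j.

(* First moment method for a random [f] with independent values, [f i]
   distributed according to [P i]. *)
Lemma exists_le_expectation (D : {set I * I}) (g : I * I -> J -> J -> R) :
  (forall p, p \in D -> p.1 != p.2) ->
  exists f : {ffun I -> J}, \sum_(p in D) g p (f p.1) (f p.2) <=
    \sum_(p in D) \sum_j \sum_j' P p.1 j * P p.2 j' * g p j j'.
Proof.
move=> offD.
pose M := \sum_(p in D) \sum_j \sum_j' P p.1 j * P p.2 j' * g p j j'.
have W0 (f : {ffun I -> J}) : 0 <= W f by exact: prodr_ge0.
have W1 : \sum_f W f = 1 by rewrite /W -(bigA_distr_bigA P) big1.
apply: contrapT => /forallNP gt.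
have {}gt (f : {ffun I -> J}) : 0 < \sum_(p in D) g p (f p.1) (f p.2) - M.
  by rewrite subr_gt0 ltNge; apply/negP => le_fM; exact: (gt f).
have : \sum_f W f * (\sum_(p in D) g p (f p.1) (f p.2) - M) = 0.
  under eq_bigr do rewrite mulrBr mulr_sumr.
  rewrite sumrB -mulr_suml W1 mul1r exchange_big /=.
  apply/eqP; rewrite subr_eq0; apply/eqP.
  by apply: eq_bigr => p /offD pD; exact: expectation_pair.
move=> /psumr_eq0P eq0; move: W1; rewrite big1 => [/eqP|f _].
  by rewrite eq_sym oner_eq0.
apply/eqP; have /eqP := eq0 (fun f _ => mulr_ge0 (W0 f) (ltW (gt f))) f isT.
by rewrite mulf_eq0 (gt_eqF (gt f)) orbF.
Qed.

End RandomAssignment.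

(** By the marginal condition [P b] is a probability law on labels. Off the diagonal the values at
    [p.1] and [p.2] are independent, so the expected sum over [D] is part of the nonnegative sum
    over all pairs, which is [k%:R ^+ 2] times the cost. *)
Lemma coupling_cost_rounding (R : realType) (k : nat) (w : 'I_k -> 'I_k -> R)
    (B1 B2 : 'M[R]_k) (D : {set 'I_k * 'I_k}) :
  (0 < k)%N -> (forall a b, 0 <= w a b) ->
  (forall b, \sum_a w a b = k%:R^-1) ->
  (forall p, p \in D -> p.1 != p.2) ->
  exists f : {ffun 'I_k -> 'I_k},
    \sum_(p in D) (B1 (f p.1) (f p.2) - B2 p.1 p.2) ^+ 2 <=
    k%:R ^+ 2 * coupling_cost w B1 B2.
Proof.
move=> k0 w0 w1 offD.
have K0 : k%:R != 0 :> R by rewrite pnatr_eq0 -lt0n.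
pose P b a : R := k%:R * w a b.
have P1 b : \sum_a P b a = 1 by rewrite -mulr_sumr w1 divff.
have P0 b a : 0 <= P b a by rewrite mulr_ge0.
have [f le_f] := exists_le_expectation P P1 P0 D
  (fun p a a' => (B1 a a' - B2 p.1 p.2) ^+ 2) offD.
exists f; apply: (le_trans le_f).
pose T (p : 'I_k * 'I_k) : R :=
  \sum_a \sum_a' P p.1 a * P p.2 a' * (B1 a a' - B2 p.1 p.2) ^+ 2.
have T0 p : 0 <= T p.
  by do 2 apply: sumr_ge0 => ? _; rewrite mulr_ge0 ?sqr_ge0// mulr_ge0.
apply: (@le_trans _ _ (\sum_p T p)).
  by rewrite [leRHS](bigID (mem D)) /= lerDl sumr_ge0.
rewrite -(pair_bigA _ (fun b b' => T (b, b'))) /=.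
under eq_bigr => b _ do rewrite /T /= exchange_big /=.
rewrite exchange_big mulr_sumr le_eqVlt; apply/predU1P; left.
apply: eq_bigr => a _; rewrite mulr_sumr; apply: eq_bigr => b _.
rewrite exchange_big mulr_sumr; apply: eq_bigr => a' _.
by rewrite mulr_sumr; apply: eq_bigr => b' _; rewrite /P; ring.
Qed.

(** * Exponential moment of the Hamming distance *)

Definition hamming {T : finType} (D : {set T}) (X C : {ffun T -> bool}) : nat :=
  #|[set p in D | X p != C p]%SET|.

(** The sum factors over coordinates: one in [D] contributes 1 + 1/e <= 3/2 = 2 (3/4), any other
    contributes 2. *)
Lemma sum_expR_hamming (R : realType) (T : finType) (D : {set T})
    (C : {ffun T -> bool}) :
  \sum_(X : {ffun T -> bool}) expR (- (hamming D X C)%:R) <=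
  2 ^+ #|T| * (3 / 4) ^+ #|D| :> R.
Proof.
pose F p (b : bool) : R := if (p \in D) && (b != C p) then expR (-1) else 1.
have e12 : expR (-1) <= 2^-1 :> R.
  by rewrite expRN lef_pV2 ?posrE ?expR_gt0//; apply: le_trans (expR_ge1Dx 1).
have -> : \sum_(X : {ffun T -> bool}) expR (- (hamming D X C)%:R) =
    \sum_(X : {ffun T -> bool}) \prod_p F p (X p).
  apply: eq_bigr => X _; rewrite /F -big_mkcond /= prodr_const -expRM_natl.
  rewrite mulrN1 /hamming; congr (expR (- _%:R)).
  by apply: eq_card => p; rewrite inE.
rewrite -(bigA_distr_bigA F).
have -> : 2 ^+ #|T| * (3 / 4) ^+ #|D| =
    \prod_(p : T) (2 * (if p \in D then 3 / 4 else 1)) :> R.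
  by rewrite big_split /= prodr_const -big_mkcond /= prodr_const.
apply: ler_prod => p _; rewrite big_bool /F.
have e0 := expR_ge0 (-1 : R).
by apply/andP; split; case: (p \in D); case: (C p) => /=; lra.
Qed.

(** * Admissible perturbations of the all-ones matrix *)

Section SignedMatrix.
Context {R : realType} {k : nat}.
Hypothesis k0 : (0 < k)%N.

(** Swaps 2j and 2j + 1. The default of [insubd] makes the unpaired last index a fixed point when
    [k] is odd. *)
Let partner (a : 'I_k) : 'I_k := insubd a (if odd a then a.-1 else a.+1).

Definition alt_sign (a : 'I_k) : R :=
  if (a < k./2.*2)%N then (-1) ^+ a else 0.

Lemma even_part_subproof (a : 'I_k) : (a - odd a < k)%N.
Proof. exact: leq_ltn_trans (leq_subr _ _) (ltn_ord a). Qed.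

Definition even_part (a : 'I_k) : 'I_k := Ordinal (even_part_subproof a).

Let val_partner (a : 'I_k) : (a < k./2.*2)%N ->
  partner a = (if odd a then a.-1 else a.+1) :> nat.
Proof.
move=> ak; rewrite /partner val_insubd (_ : (_ < k)%N = true)//.
by have := odd_double_half a; have := odd_double_half k; case: ifP => _; lia.
Qed.

Let partner_last (a : 'I_k) : ~~ (a < k./2.*2)%N -> partner a = a.
Proof.
move=> ak; apply: val_inj.
rewrite /partner val_insubd (_ : (_ < k)%N = false)//.
have := ltn_ord a; have := odd_double_half a; have := odd_double_half k.
by move: ak; case: (odd a) => /=; lia.
Qed.

(** The involution [partner] negates [alt_sign] and preserves [even_part], so the sum equals its own
    opposite. *)
Lemma sum_alt_sign (g : 'I_k -> R) :
  \sum_a alt_sign a * g (even_part a) = 0.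
Proof.
have partner_lt a : (partner a < k./2.*2)%N = (a < k./2.*2)%N.
  have [ak|ak] := boolP (a < k./2.*2)%N.
    rewrite val_partner//; have := odd_double_half a.
    by case: (odd a) => /=; lia.
  by rewrite partner_last// (negbTE ak).
have partnerK : involutive partner.
  move=> a; have [ak|ak] := boolP (a < k./2.*2)%N.
  2: by rewrite !partner_last.
  apply: val_inj; rewrite /= val_partner ?partner_lt// val_partner//.
  case: (boolP (odd a)) => oa; first by case: (a : nat) oa => //= m /negbTE ->.
  by rewrite /= oa.
have alt_partner a : alt_sign (partner a) = - alt_sign a.
  rewrite /alt_sign partner_lt; case: ifP => ak; last by rewrite oppr0.
  rewrite val_partner//; case: (boolP (odd a)) => oa.
  2: by rewrite exprS mulN1r.
  by case: (a : nat) oa => // m _; rewrite exprS mulN1r opprK.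
have even_partner a : even_part (partner a) = even_part a.
  have [ak|ak] := boolP (a < k./2.*2)%N; last by rewrite partner_last.
  apply: val_inj => /=; rewrite val_partner//.
  case: (boolP (odd a)) => oa /=; last by rewrite oa; lia.
  by case: (a : nat) oa => //= m /negbTE ->; lia.
set S := LHS; suff : S = - S by move: S => S; lra.
rewrite {1}/S (reindex_inj (inv_inj partnerK)) -sumrN; apply: eq_bigr => a _.
by rewrite alt_partner even_partner mulNr.
Qed.

Lemma alt_sign_sqr a : alt_sign a ^+ 2 <= 1.
Proof.
by rewrite /alt_sign; case: ifP => _; rewrite ?expr0n// sqrr_sign.
Qed.

(* Rows [2 j] and [2 j + 1] deviate from [1] by opposite amounts, so that the
   entries average to [1] for every [f]. *)
Definition signed_mx (f : 'I_k -> 'I_k -> R) : 'M[R]_k :=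
  \matrix_(a, b) (1 + alt_sign a * alt_sign b * f (even_part a) (even_part b)).

Lemma admissible_signed_mx (f : 'I_k -> 'I_k -> R) :
  (forall a b, f a b = f b a) -> (forall a b, f a b ^+ 2 <= 1) ->
  admissible (signed_mx f).
Proof.
move=> symf f1; split.
- by apply/matrixP => a b; rewrite !mxE symf; ring.
- move=> a b; rewrite mxE.
  set x := alt_sign a; set y := alt_sign b; set z := f _ _.
  have : (x * y * z) ^+ 2 <= 1.
    have x1 : x ^+ 2 <= 1 := alt_sign_sqr a.
    have y1 : y ^+ 2 <= 1 := alt_sign_sqr b.
    rewrite !exprMn; apply: mulr_ile1; rewrite ?sqr_ge0 ?f1//.
      by rewrite mulr_ge0 ?sqr_ge0.
    by apply: mulr_ile1; rewrite ?sqr_ge0.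
  by move: (x * y * z) => t t1; apply/andP; split; nra.
have -> : \sum_a \sum_b signed_mx f a b = (k ^ 2)%:R.
  transitivity (\sum_(a < k) k%:R : R).
    apply: eq_bigr => a _.
    under eq_bigr do rewrite mxE -mulrA [alt_sign a * _]mulrC.
    rewrite big_split /= sumr_const card_ord -[X in _ + X]mulr_suml.
    by rewrite sum_alt_sign mul0r addr0.
  by rewrite sumr_const card_ord -mulnn natrM mulr_natr.
by rewrite divff// pnatr_eq0 expn_eq0 negb_and -lt0n k0.
Qed.

(** Only the last index can carry the sign 0. *)
Lemma sum_alt_sign_sqr : k%:R - 1 <= \sum_a alt_sign a ^+ 2.
Proof.
have le_last (a : 'I_k) : (a.+1 != k)%:R <= alt_sign a ^+ 2 :> R.
  rewrite /alt_sign; case: ifP => [_|/negbT ak]; first by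
    rewrite sqrr_sign; case: (_ != _).
  rewrite expr0n /= (_ : a.+1 != k = false)//; apply/negbTE; rewrite negbK.
  have := odd_double_half k; have := ltn_ord a.
  by move: ak; case: (odd k) => /=; lia.
apply: le_trans (ler_sum _ (fun a _ => le_last a)).
case: k k0 => // m _; rewrite big_ord_recr /= eqxx addr0 -[m.+1%:R]natr1 addrK.
rewrite (eq_bigr (fun=> 1)) => [|a _]; first by rewrite sumr_const card_ord.
by rewrite eqSS /= ltn_eqF.
Qed.

End SignedMatrix.

(** * The matrices indexed by bit arrays, and how many lie near one output *)

Section SignedFamily.
Context {R : realType} {k : nat}.
Hypothesis k0 : (0 < k)%N.

(** Reading [X] only on and above the diagonal makes the pattern symmetric. *)
Definition bit_sign (X : {ffun 'I_k * 'I_k -> bool}) (a b : 'I_k) : R :=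
  if X (if (a <= b)%N then (a, b) else (b, a)) then 1 else -1.

Definition bit_mx (X : {ffun 'I_k * 'I_k -> bool}) : 'M[R]_k :=
  signed_mx (bit_sign X).

Lemma admissible_bit_mx X : admissible (bit_mx X).
Proof.
apply: admissible_signed_mx => // a b; rewrite /bit_sign.
  by case: ltngtP => // /val_inj ->.
by case: (X _); rewrite ?expr1n ?sqrrN ?expr1n.
Qed.

(* Positions [(a, b)] at which [bit_mx X a b] is [1 +- 1] according to the bit
   [X (a, b)]. *)
Definition free_bits : {set 'I_k * 'I_k} :=
  [set p : 'I_k * 'I_k | [&& ~~ odd p.1, ~~ odd p.2, (p.1 < (k %/ 4).*2)%N &
     ((k %/ 4).*2 <= p.2 < (k %/ 4).*2.*2)%N]]%SET.

Lemma card_free_bits : ((k %/ 4) ^ 2 <= #|free_bits|)%N.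
Proof.
set q := (k %/ 4)%N.
have k4 : (q * 4 <= k)%N by exact: leq_trunc_div.
have ub (i : 'I_q) : (i.*2 < k)%N by have := ltn_ord i; lia.
have vb (i : 'I_q) : (q.*2 + i.*2 < k)%N by have := ltn_ord i; lia.
(* The free positions include all (2i, 2q + 2j) with i, j < q. *)
pose h (p : 'I_q * 'I_q) := (Ordinal (ub p.1), Ordinal (vb p.2)).
have h_inj : injective h.
  move=> [i j] [i' j'] [/double_inj/val_inj -> /addnI/double_inj/val_inj ->] //.
rewrite (_ : (q ^ 2)%N = #|[set h p | p : 'I_q * 'I_q]%SET|); last first.
  by rewrite card_imset// card_prod card_ord.
apply: subset_leq_card; apply/fintype.subsetP => _ /imsetP[[i j] _ ->].
rewrite inE /= -/q oddD !odd_double /= leq_addr /=.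
by have := ltn_ord i; have := ltn_ord j; lia.
Qed.

Lemma free_bits_lt p : p \in free_bits -> (p.1 < p.2)%N.
Proof. by rewrite inE => /and4P[_ _ lt /andP[+ _]]; exact: leq_trans. Qed.

(** Even indices below 4 (k %/ 4) have sign 1 and are their own even part. *)
Lemma bit_mx_free X p : p \in free_bits ->
  bit_mx X p.1 p.2 = if X p then 2 else 0.
Proof.
move=> pD; have /ltnW le12 := free_bits_lt _ pD.
move: p pD le12 => [a b]; rewrite inE /= => /and4P[ea eb a2 /andP[_ b4]] leab.
have qk : ((k %/ 4).*2.*2 <= k./2.*2)%N.
  have := leq_trunc_div k 4; have := odd_double_half k.
  by case: (odd k) => /=; lia.
have signE (c : 'I_k) : ~~ odd c -> (c < (k %/ 4).*2.*2)%N ->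
    alt_sign c = 1 :> R /\ even_part c = c.
  move=> ec ck; split; last by apply: val_inj => /=; rewrite (negbTE ec) subn0.
  by rewrite /alt_sign (leq_trans ck qk) -signr_odd (negbTE ec).
rewrite mxE; have [|-> ->] := signE a ea; first by lia.
have [|-> ->] := signE b eb; first by lia.
by rewrite /bit_sign leab; case: (X _) => /=; ring.
Qed.

(** Free entries are 0 or 2, so an entry of [M] on the wrong side of the threshold 1 has squared
    error at least 1. *)
Lemma hamming_bit_mx_le (X : {ffun 'I_k * 'I_k -> bool})
    (M : 'I_k -> 'I_k -> R) :
  (hamming free_bits X [ffun p => 1 <= M p.1 p.2])%:R <=
  \sum_(p in free_bits) (M p.1 p.2 - bit_mx X p.1 p.2) ^+ 2.
Proof.
rewrite /hamming -sum1_card natr_sum.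
rewrite (eq_bigl (fun p => (p \in free_bits) && (X p != (1 <= M p.1 p.2)))).
  2: by move=> p; rewrite inE ffunE.
rewrite big_mkcondr /=; apply: ler_sum => p pD; rewrite bit_mx_free//.
by case: (X p); case: (lerP 1 (M p.1 p.2)) => /= M1; rewrite ?sqr_ge0//; nra.
Qed.

Lemma delta2_bit_mx (Bhat : 'M[R]_k) X : delta2 Bhat (bit_mx X) <= 1 / 20 ->
  exists f : {ffun 'I_k -> 'I_k},
    (hamming free_bits X [ffun p => 1 <= Bhat (f p.1) (f p.2)])%:R <=
    k%:R ^+ 2 / 324 :> R.
Proof.
(* Relaxing 1/20 to 1/18 gives the strict inequality needed to extract a coupling; 324 is 18
   squared. *)
move=> dB; have : delta2 Bhat (bit_mx X) < 1 / 18.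
  by apply: le_lt_trans dB _; lra.
case/(delta2_ltP k0 Bhat (bit_mx X)) => [|phi [[m1 m2] cost]]; first by lra.
have [f le_f] := coupling_cost_rounding R k _ Bhat (bit_mx X) free_bits k0
  (coupling_weight_ge0 (phi1 := phi.1) (phi2 := phi.2))
  (coupling_weight_suml m1 m2)
  (fun p pD => negbT (ltn_eqF (free_bits_lt p pD))).
exists f; apply: (le_trans (hamming_bit_mx_le X (fun a b => Bhat (f a) (f b)))).
apply: (le_trans le_f); apply: ler_wpM2l; first by rewrite sqr_ge0.
by apply: ltW; apply: (lt_le_trans cost); lra.
Qed.

Lemma count_delta2_bit_mx (Bhat : 'M[R]_k) :
  \sum_(X : {ffun 'I_k * 'I_k -> bool})
     (delta2 Bhat (bit_mx X) <= 1 / 20)%R%:R <=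
  2 ^+ (k * k) * (k%:R ^+ k * expR (k%:R ^+ 2 / 324) *
     (3 / 4) ^+ ((k %/ 4) ^ 2)) :> R.
Proof.
pose C (f : {ffun 'I_k -> 'I_k}) : {ffun 'I_k * 'I_k -> bool} :=
  [ffun p => 1 <= Bhat (f p.1) (f p.2)].
set r := k%:R ^+ 2 / 324.
(* A union bound over the maps [f], in which the indicator of [hamming <= r] is dominated by the
   exponential of [r - hamming]. *)
apply: (@le_trans _ _ (\sum_(X : {ffun 'I_k * 'I_k -> bool})
   \sum_f expR r * expR (- (hamming free_bits X (C f))%:R))).
  apply: ler_sum => X _; case: (boolP (delta2 _ _ <= _)) => [dB|_]; last first.
    by apply: sumr_ge0 => f _; rewrite -expRD expR_ge0.
  have [f le_f] := delta2_bit_mx _ _ dB.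
  rewrite (bigD1 f)//= -expRD.
  apply: (@le_trans _ _ (expR (r - (hamming free_bits X (C f))%:R))).
    by apply: le_trans (expR_ge1Dx _); rewrite lerDl subr_ge0.
  by rewrite lerDl; apply: sumr_ge0 => g _; rewrite -expRD expR_ge0.
rewrite exchange_big /=.
apply: (@le_trans _ _ (\sum_(f : {ffun 'I_k -> 'I_k})
    expR r * (2 ^+ (k * k) * (3 / 4) ^+ ((k %/ 4) ^ 2)))).
  apply: ler_sum => f _; rewrite -mulr_sumr ler_wpM2l ?expR_ge0//.
  apply: (le_trans (sum_expR_hamming _ _ _ _)).
  rewrite card_prod card_ord ler_wpM2l ?exprn_ge0//.
  by apply: ler_wiXn2l card_free_bits; lra.
rewrite sumr_const card_ffun card_ord -[leLHS]mulr_natl natrX.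
by rewrite le_eqVlt; apply/predU1P; left; ring.
Qed.

End SignedFamily.

(** * Two admissible matrices that share no close output *)

Lemma sum_coupling_marginal (R : realType) (k : nat) (w : 'I_k -> 'I_k -> R)
    (h : 'I_k -> 'I_k -> R) (s : R) :
  (forall a, \sum_b w a b = s) ->
  \sum_a \sum_b \sum_a' \sum_b' w a b * w a' b' * h a a' =
  s ^+ 2 * \sum_a \sum_a' h a a'.
Proof.
move=> ws; rewrite mulr_sumr; apply: eq_bigr => a _.
rewrite exchange_big mulr_sumr; apply: eq_bigr => a' _ /=.
transitivity (\sum_b w a b * (s * h a a')).
  by apply: eq_bigr => b _; rewrite -mulr_suml -mulr_sumr ws mulrA.
by rewrite -mulr_suml ws; ring.
Qed.

(** Against the constant all-ones matrix the cost is the mean of [h] under any coupling, so it can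
    be transferred from [w] to [v]. Then the mean of [g] is below 4/324, whereas it equals the
    square of the mean of [alt_sign ^+ 2], at least 1/4. *)
Lemma signed_mx_delta2_disjoint (R : realType) (k : nat) (Bhat : 'M[R]_k) :
  (2 <= k)%N ->
  delta2 Bhat (signed_mx (fun _ _ => 0)) <= 1 / 20 ->
  delta2 Bhat (signed_mx (fun _ _ => 1)) <= 1 / 20 -> False.
Proof.
move=> k2; have k0 : (0 < k)%N by exact: ltnW.
have K2 : 2 <= k%:R :> R by rewrite ler_nat.
have close B : delta2 Bhat B <= 1 / 20 ->
    exists phi : (R -> 'I_k) * (R -> 'I_k),
    (measure_preserving phi.1 /\ measure_preserving phi.2) /\
    coupling_cost (coupling_weight phi.1 phi.2) Bhat B < (1 / 18) ^+ 2.
  move=> dB; apply/(delta2_ltP k0 Bhat B); first by lra.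
  by apply: le_lt_trans dB _; lra.
move=> /close[[phi1 phi2] /= [[m1 m2] cost0]].
move=> /close[[psi1 psi2] /= [[n1 n2] cost1]].
set w := coupling_weight phi1 phi2 in cost0.
set v := coupling_weight psi1 psi2 in cost1.
have row1 (f g : R -> 'I_k) : measure_preserving f -> measure_preserving g ->
    forall a, \sum_b coupling_weight f g a b = k%:R^-1.
  move=> mf mg a; rewrite -(coupling_weight_suml mg mf a).
  by apply: eq_bigr => b _; rewrite coupling_weight_swap.
pose h (a a' : 'I_k) : R := (Bhat a a' - 1) ^+ 2.
pose g (b b' : 'I_k) : R := (alt_sign b * alt_sign b') ^+ 2.
have costE : coupling_cost w Bhat (signed_mx (fun _ _ => 0)) =
    k%:R^-1 ^+ 2 * \sum_a \sum_a' h a a'.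
  rewrite -(sum_coupling_marginal _ _ w) ?row1//; last exact: row1.
  do 4 (apply: eq_bigr => ? _); by rewrite mxE mulr0 addr0.
have hE : \sum_a \sum_b \sum_a' \sum_b' v a b * v a' b' * h a a' =
    k%:R^-1 ^+ 2 * \sum_a \sum_a' h a a'.
  by apply: sum_coupling_marginal; exact: row1.
have gE : \sum_a \sum_b \sum_a' \sum_b' v a b * v a' b' * g b b' =
    k%:R^-1 ^+ 2 * \sum_b \sum_b' g b b'.
  rewrite -(sum_coupling_marginal _ _ (fun b a => v a b)); last first.
    exact: coupling_weight_suml.
  rewrite exchange_big; apply: eq_bigr => b _; apply: eq_bigr => a _ /=.
  by rewrite exchange_big.
have : \sum_a \sum_b \sum_a' \sum_b' v a b * v a' b' * g b b' <=
    2 * coupling_cost v Bhat (signed_mx (fun _ _ => 1)) +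
    2 * \sum_a \sum_b \sum_a' \sum_b' v a b * v a' b' * h a a'.
  rewrite /coupling_cost !mulr_sumr -big_split; apply: ler_sum => a _ /=.
  rewrite !mulr_sumr -big_split; apply: ler_sum => b _ /=.
  rewrite !mulr_sumr -big_split; apply: ler_sum => a' _ /=.
  rewrite !mulr_sumr -big_split; apply: ler_sum => b' _ /=.
  rewrite !(mulrCA 2) -mulrDr; apply: ler_wpM2l.
    by apply: mulr_ge0; exact: coupling_weight_ge0.
  rewrite mxE mulr1 /g /h; set x := Bhat a a'; set y := _ * _.
  (* With z = x - 1, the difference 2 (z - y)^2 + 2 z^2 - y^2 is the square of 2 z - y. *)
  have := sqr_ge0 (2 * (x - 1) - y); nra.
rewrite hE -costE gE => le_cost.
have {le_cost} : k%:R^-1 ^+ 2 * \sum_b \sum_b' g b b' < 1 / 4.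
  by apply: (le_lt_trans le_cost); lra.
apply/negP; rewrite -leNgt.
have -> : \sum_b \sum_b' g b b' = (\sum_(b : 'I_k) alt_sign b ^+ 2) ^+ 2.
  rewrite expr2 mulr_suml; apply: eq_bigr => b _; rewrite mulr_sumr.
  by apply: eq_bigr => b' _; rewrite /g exprMn.
have := sum_alt_sign_sqr k0 (R := R); set S := \sum_b _ => leS.
(* Since 2 <= k, the ratio (k - 1) / k is at least 1/2. *)
rewrite -exprMn -[leLHS](_ : (1 / 2) ^+ 2 = _); last by field.
rewrite ler_sqr ?nnegrE; [|lra|]; last by rewrite mulr_ge0 ?invr_ge0//; lra.
by rewrite [leRHS]mulrC ler_pdivlMr; lra.
Qed.

(** * Double counting over outputs, and numerical estimates *)

(** Integrating against [P] the number of sets that contain a point bounds the sum of their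
    probabilities. *)
Lemma sum_probability_le (R : realType) d (T : measurableType d)
    (P : probability T R) (I : finType) (S : I -> set T) (N : R) :
  (forall i, measurable (S i)) ->
  (forall x, \sum_i (x \in S i)%:R <= N) ->
  \sum_i fine (P (S i)) <= N.
Proof.
move=> mS leN; rewrite -lee_fin -sumEFin.
have -> : (\sum_i (fine (P (S i)))%:E = \sum_i \int[P]_x (\1_(S i) x)%:E)%E.
  apply: eq_bigr => i _; rewrite integral_indic// setIT fineK//.
  exact: fin_num_measure.
rewrite -ge0_integral_sum//; last first.
  by move=> i; apply/measurable_EFinP/measurable_indic.
apply: (@le_trans _ _ (\int[P]_x (cst N%:E x))%E).
  apply: ge0_le_integral => //.
  - by move=> x _; apply: sume_ge0 => i _; rewrite lee_fin.
  - by apply: emeasurable_sum => i; apply/measurable_EFinP/measurable_indic.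
  - by move=> x _; rewrite sumEFin lee_fin; exact: leN.
have PT : P [set: T]%classic = 1%E := probability_setT P.
by rewrite integral_cst// [X in (_ * X)%E]PT mule1.
Qed.

Lemma count_delta2_signed_mx (R : realType) (k : nat) (Bhat : 'M[R]_k) (r : R) :
  (2 <= k)%N -> r <= 1 / 20 ->
  \sum_(b : bool)
     (delta2 Bhat (signed_mx (fun _ _ => (b : nat)%:R)) <= r)%R%:R <= 1 :> R.
Proof.
move=> k2 r20; rewrite big_bool.
pose close (b : bool) := delta2 Bhat (signed_mx (fun _ _ => (b : nat)%:R)) <= r.
have disj : close false -> close true -> False.
  move=> d0 d1.
  exact: signed_mx_delta2_disjoint k2 (le_trans d0 r20) (le_trans d1 r20).
rewrite -[leLHS]/((close true)%:R + (close false)%:R).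
case: (close true) disj => [|_].
  2: by case: (close false); rewrite /= ?addr0 ?add0r.
by case: (close false) => [disj|_]; [case: disj|rewrite /= addr0].
Qed.

(** The hypothesis gives x <= (x / c)^2, and x / c is at most its exponential. With c = 800 this
    makes k^k at most e^(k^2 / 400). *)
Lemma le_expR_sqr (R : realType) (c x : R) :
  0 < c -> c ^+ 2 <= x -> x <= expR (2 * (x / c)).
Proof.
move=> c0 cx; have x0 : 0 <= x by apply: le_trans cx; exact: sqr_ge0.
apply: (@le_trans _ _ ((x / c) ^+ 2)).
  by rewrite expr_div_n ler_pdivlMr ?exprn_gt0// expr2 ler_wpM2l.
have xc0 : 0 <= x / c by rewrite divr_ge0// ltW.
rewrite expRM_natl ler_sqr ?nnegrE ?expR_ge0//.
by have := expR_ge1Dx (x / c); lra.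
Qed.

(** In logarithms, the maps cost k^2/400, the Hamming radius costs k^2/324, and the factor 3/4 gains
    k^2/100. The net gain exceeds k^2/250 by more than the 1/2 lost in bounding 2/3 below by
    e^(-1/2). *)
Lemma packing_bound (R : realType) (k : nat) (y : R) :
  800 ^+ 2 <= k%:R :> R ->
  2 / 3 <= expR y * (k%:R ^+ k * expR (k%:R ^+ 2 / 324) *
                       (3 / 4) ^+ ((k %/ 4) ^ 2)) ->
  k%:R ^+ 2 / 250 <= y.
Proof.
move=> k_large le_V; have K0 : 0 <= k%:R :> R := ler0n _ _.
have K_le_exp : k%:R <= expR (k%:R / 400) :> R.
  by apply: (le_trans (le_expR_sqr _ _ _ _ k_large)); rewrite ?ler_expR; lra.
have Kk_le : k%:R ^+ k <= expR (k%:R ^+ 2 / 400) :> R.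
  rewrite expr2 -mulrA expRM_natl.
  by apply: lerXn2r; rewrite ?nnegrE ?expR_ge0 ?ler0n.
(* For 15 <= k the quotient k %/ 4 is at least the remainder, hence at least k / 5. *)
have q_ge : k%:R ^+ 2 / 25 <= ((k %/ 4) ^ 2)%:R :> R.
  have : k%:R <= 5 * (k %/ 4)%:R :> R.
    have k15 : (15 <= k)%N.
      by rewrite -(ler_nat R); apply: le_trans k_large; lra.
    rewrite -natrM ler_nat.
    by have := divn_eq k 4; have := ltn_pmod k (isT : (0 < 4)%N); lia.
  rewrite natrX; move: ((k %/ 4)%:R : R) => q le_q.
  have : k%:R ^+ 2 <= (5 * q) ^+ 2 by rewrite ler_sqr ?nnegrE //; lra.
  lra.
have pow_le : (3 / 4) ^+ ((k %/ 4) ^ 2) <= expR (- (k%:R ^+ 2 / 100)) :> R.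
  apply: (@le_trans _ _ (expR (- (1 / 4)) ^+ ((k %/ 4) ^ 2))).
    apply: lerXn2r; rewrite ?nnegrE ?expR_ge0//.
    by have := expR_ge1Dx (- (1 / 4) : R); lra.
  by rewrite -expRM_natl ler_expR; lra.
have : 2 / 3 <=
    expR (y + (k%:R ^+ 2 / 400 + k%:R ^+ 2 / 324 - k%:R ^+ 2 / 100)).
  apply: (le_trans le_V); rewrite expRD ler_wpM2l ?expR_ge0// expRD.
  apply: ler_pM; [|exact: exprn_ge0| |exact: pow_le].
    by rewrite mulr_ge0 ?expR_ge0 ?exprn_ge0.
  by rewrite expRD ler_wpM2r ?expR_ge0.
have half_le : expR (- (1 / 2)) <= 2 / 3 :> R.
  rewrite expRN -[leRHS]invf_div lef_pV2 ?posrE ?expR_gt0//.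
  by have := expR_ge1Dx (1 / 2 : R); lra.
move=> /(le_trans half_le); rewrite ler_expR.
have : 800 ^+ 2 <= k%:R ^+ 2 :> R.
  by rewrite ler_sqr ?nnegrE ?ler0n//; apply: le_trans k_large; lra.
lra.
Qed.

(** * The lower bound on n *)

(** Group privacy compares every input with the empty graph; the resulting bound is uniform in [G],
    so averaging over the block model keeps it. *)
Lemma success_probability_le (R : realType) (n k : nat) (d eps : R)
    (A : algorithm R n k) (B : 'M[R]_k) (r : R) :
  (0 < k)%N -> 0 <= r -> block_model_defined n d B -> node_private eps A ->
  (success_probability d A B r <=
   (expR (n%:R * eps) *
    fine (A (empty_sgraph n) [set Bhat | delta2 Bhat B <= r]%classic))%:E)%E.
Proof.
move=> k0 r0 defB privA; set S := [set _ | _]%classic; set t := _ * _.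
have mS : measurable (S : set (borel_matrix R k)).
  exact: measurable_delta2_ball k0 _ _ r0.
have t0 : 0 <= t by rewrite mulr_ge0 ?expR_ge0 ?fine_ge0.
have AS (G : sgraph n) : (A G S <= t%:E)%E.
  rewrite EFinM fineK; last exact: fin_num_measure.
  exact: node_private_group.
apply: (@le_trans _ _ (\sum_(G : sgraph n) (block_model d B G * t)%:E)%E).
  apply: lee_sum => G _; rewrite EFinM; apply: lee_wpmul2l (AS G).
  by rewrite lee_fin block_model_ge0.
rewrite sumEFin -mulr_suml lee_fin -[leRHS]mul1r.
exact: ler_wpM2r (block_model_sum_le1 defB).
Qed.

Theorem theorem1p4 (R : realType) :
  exists c : R, 0 < c /\
    forall (n k : nat) (d eps : R),
      (2 <= k)%N -> 0 < eps ->
      (forall B0 : 'M[R]_k, admissible B0 -> block_model_defined n d B0) ->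
      (exists A : algorithm R n k,
          node_private eps A /\
          forall B0 : 'M[R]_k, admissible B0 ->
            ((2 / 3)%:E <= success_probability d A B0 (1 / 20))%E) ->
      c * (k%:R ^+ 2 / eps) <= n%:R.
Proof.
(* [t] hides the numeral [800], which the unifier would expand in unary. *)
have [t t250 tE] : exists2 t : R, 250 <= t & t = 800 by exists 800; lra.
have t0 : 0 < t by lra.
(* The constant is set by the case [k < t ^+ 2]: there k^2 < t^4 while [n%:R * eps] is at least 1/4.
   In the other case 250 <= 4 t^4 suffices. *)
exists (4 * t ^+ 4)^-1; split=> [|n k d eps k2 eps0 defB [A [privA succA]]].
  by rewrite invr_gt0 mulr_gt0// exprn_gt0.
have k0 : (0 < k)%N by exact: ltnW.
rewrite mulrA ler_pdivrMr//.
pose ball (B : 'M[R]_k) : set (borel_matrix R k) :=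
  [set Bhat | delta2 Bhat B <= 1 / 20]%classic.
pose m B := fine (A (empty_sgraph n) (ball B)).
have m_ge B : admissible B -> 2 / 3 <= expR (n%:R * eps) * m B.
  move=> admB; rewrite -lee_fin; apply: le_trans (succA B admB) _.
  by apply: success_probability_le => //; exact: defB.
have mball B : measurable (ball B) by exact: measurable_delta2_ball.
have [k_large|k_small] := leP (t ^+ 2) (k%:R : R).
  suff : k%:R ^+ 2 / 250 <= n%:R * eps.
    apply: le_trans; rewrite [leLHS]mulrC ler_wpM2l ?sqr_ge0//.
    have t1 : 1 <= t by lra.
    have := ler_eXnr (isT : (0 < 4)%N) t1.
    move=> le_t; rewrite lef_pV2 ?posrE; first by lra.
      by rewrite mulr_gt0// exprn_gt0.
    by lra.
  apply: packing_bound; first by rewrite -tE.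
  set V := (X in _ <= _ * X).
  (* Summing [m_ge] over all 2^(k^2) arrays and cancelling that number leaves the hypothesis of
     [packing_bound]. *)
  have : \sum_(X : {ffun 'I_k * 'I_k -> bool}) m (bit_mx X) <= 2 ^+ (k * k) * V.
    apply: sum_probability_le => // Bhat.
    apply: le_trans (count_delta2_bit_mx k0 Bhat).
    by apply: ler_sum => X _; rewrite /ball mem_setE.
  move=> /(ler_wpM2l (expR_ge0 (n%:R * eps))); rewrite mulr_sumr => le_sum.
  have : \sum_(X : {ffun 'I_k * 'I_k -> bool}) (2 / 3) <=
      expR (n%:R * eps) * (2 ^+ (k * k) * V).
    apply: le_trans le_sum; apply: ler_sum => X _.
    exact/m_ge/admissible_bit_mx.
  rewrite sumr_const card_ffun card_bool card_prod card_ord.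
  rewrite -[_ *+ (_ ^ _)]mulr_natl natrX.
  by rewrite [leRHS]mulrCA ler_pM2l ?exprn_gt0.
have adm (b : bool) : admissible (signed_mx (fun _ _ : 'I_k => b%:R : R)).
  by apply: admissible_signed_mx => // _ _; case: b => /=; lra.
have le1 : \sum_(b : bool) m (signed_mx (fun _ _ => (b : nat)%:R)) <= 1.
  apply: sum_probability_le => // Bhat.
  apply: le_trans (count_delta2_signed_mx _ _ Bhat _ k2 (lexx _)).
  by apply: ler_sum => b _; rewrite /ball mem_setE.
rewrite big_bool in le1.
(* Adding the two lower bounds gives 4/3 <= e (u + v) <= e. *)
have two_points (e u v : R) :
    0 <= e -> 2 / 3 <= e * u -> 2 / 3 <= e * v -> u + v <= 1 -> 4 / 3 <= e.
  by move=> *; nra.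
have exp_ge : 4 / 3 <= expR (n%:R * eps).
  exact: two_points (expR_ge0 _) (m_ge _ (adm true)) (m_ge _ (adm false)) le1.
have ge14 : 1 / 4 <= n%:R * eps.
  (* The tangent bound 1 - x <= e^(-x) <= 3/4 avoids logarithms. *)
  have := expR_ge1Dx (- (n%:R * eps)); rewrite expRN => le_inv.
  have : (expR (n%:R * eps))^-1 <= (4 / 3)^-1.
    by rewrite lef_pV2 ?posrE ?expR_gt0//; lra.
  by rewrite invf_div; lra.
apply: le_trans ge14.
rewrite invfM -mulrA mul1r -[leRHS]mulr1 ler_wpM2l//.
rewrite mulrC ler_pdivrMr ?exprn_gt0// mul1r.
have -> : t ^+ 4 = (t ^+ 2) ^+ 2 by rewrite -exprM.
by rewrite ler_sqr ?nnegrE ?exprn_ge0// ltW.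
Qed.
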